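(* Let $(X,d)$ be a metric space of bounded geometry. Then the following conditions are equivalent: (a) $X$ has Property A; (b) $X$ is large scale paracompact.
   Context: Bounded geometry: for every $r>0$ there is a natural number $M$ such that every ball of radius $r$ in $X$ contains at most $M$ elements. Property A: for all $R,\epsilon>0$ there are $M>0$ and a partition of unity $\{\phi_s\}_{s\in S}$ on $X$ (functions $\phi_s\colon X\to[0,1]$, not required continuous, with $\sum_{s\in S}\phi_s(x)=1$ for every $x\in X$) such that (i) $d(x,y)\le R$ implies $\sum_{s\in S}|\phi_s(x)-\phi_s(y)|<\epsilon$, and (ii) the diameter of the support $\{x:\phi_s(x)>0\}$ of each $\phi_s$ is at most $M$. Simplicial complexes: for a set $S$, $\Delta(S)$ is the set of functions $p\colon S\to[0,1]$ with finite support and $\sum_{s\in S}p(s)=1$, with the $l^1$-metric $\|p-q\|_1=\sum_s|p(s)-q(s)|$. A simplicial complex $K$ is a subcomplex of $\Delta(S)$ for some set $S$, with the induced metric; $K^{(0)}$ is its vertex set, and $st(v)=\{p\in K: p(v)>0\}$ for $v\in K^{(0)}$. A function $f\colon X\to Y$ of metric spaces is $(\lambda,C)$-Lipschitz if $d_Y(f(x),f(y))\le\lambda\, d_X(x,y)+C$ for all $x,y$. A family of subsets is uniformly bounded if the diameters of its members have a common finite upper bound. A cover $\mathcal U$ refines $\mathcal V$ if each member of $\mathcal U$ is contained in some member of $\mathcal V$. $X$ is large scale paracompact if for each uniformly bounded cover $\mathcal U$ of $X$ and all $\lambda,C>0$ there are a simplicial complex $K$ and a $(\lambda,C)$-Lipschitz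 function $f\colon X\to K$ such that $\mathcal V:=\{f^{-1}(st(v))\}_{v\in K^{(0)}}$ is uniformly bounded and $\mathcal U$ refines $\mathcal V$. *)

(* Defs.v *)
From HB Require Import structures.
From mathcomp Require Import all_boot all_order all_algebra.
From mathcomp Require Import finmap.
From mathcomp Require Import mathcomp_extra boolp classical_sets functions.
From mathcomp Require Import cardinality fsbigop reals ereal topology esum.

Set Implicit Arguments.
Unset Strict Implicit.
Unset Printing Implicit Defensive.

Import Order.TTheory GRing.Theory Num.Theory.

Local Open Scope classical_set_scope.
Local Open Scope ring_scope.
Local Open Scope card_scope.

Section coarse_geometry.
Context {R : realType}.

(* The diameter of set0 is -oo, so the empty set satisfies every bound. *)
Definition diam {X : metricType R} (A : set X) : \bar R :=
  ereal_sup [set (mdist x y)%:E | x in A & y in A].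

Definition bounded_geometry (X : metricType R) :=
  forall r : R, 0 < r ->
    exists M : nat, forall x : X, ball x r #<= `I_M.

Definition uniformly_bounded {X : metricType R} (U : set (set X)) :=
  exists M : R, forall A, U A -> (diam A <= M%:E)%E.

Definition is_cover {X : Type} (U : set (set X)) := cover U id = [set: X].

Definition refines {X : Type} (U V : set (set X)) :=
  forall A, U A -> exists2 B, V B & A `<=` B.

Definition coarse_lipschitz {X Y : metricType R} (lambda C : R) (f : X -> Y) :=
  forall x y : X, mdist (f x) (f y) <= lambda * mdist x y + C.

(* The index type S may be infinite and need not be countable: the sums over S
   are unordered sums of nonnegative terms with values in \bar R. *)
Definition partition_of_unity {X : Type} {S : choiceType} (phi : S -> X -> R) :=
  (forall s x, 0 <= phi s x <= 1) /\
  (forall x, \esum_(s in [set: S]) (phi s x)%:E = 1%E).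

Definition property_A (X : metricType R) :=
  forall r eps : R, 0 < r -> 0 < eps ->
    exists M : R, 0 < M /\
    exists (S : choiceType) (phi : S -> X -> R),
      [/\ partition_of_unity phi,
          (forall x y : X, mdist x y <= r ->
             (\esum_(s in [set: S]) `|phi s x - phi s y|%:E < eps%:E)%E) &
          (forall s : S, (diam [set x | (0 < phi s x)%R] <= M%:E)%E)].

End coarse_geometry.

Section full_complex.
Context {R : realType} {S : choiceType}.

Record Delta := MkDelta {
  weight :> S -> R ;
  weight_itv : forall s, 0 <= weight s <= 1 ;
  weight_finite : finite_set [set s | weight s != 0] ;
  weight_sum : \sum_(s \in [set: S]) weight s = 1 }.

HB.instance Definition _ := gen_eqMixin Delta.
HB.instance Definition _ := gen_choiceMixin Delta.

Lemma Delta_eq (p q : Delta) : weight p =1 weight q -> p = q.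
Proof.
case: p q => [p p1 p2 p3] [q q1 q2 q3] /= /funext pq.
by case: _ / pq q1 q2 q3 => *; congr MkDelta; exact: Prop_irrelevance.
Qed.

Definition l1dist (p q : Delta) : R := \sum_(s \in [set: S]) `|p s - q s|.

Lemma l1dist_fsetE (p q : Delta) (A : {fset S}) :
  [set s | p s != 0] `<=` [set` A] -> [set s | q s != 0] `<=` [set` A] ->
  l1dist p q = \sum_(s <- A) `|p s - q s|.
Proof.
move=> pA qA; rewrite /l1dist.
rewrite -(fsbig_widen [set` A]) ?fsbig_finite ?set_fsetK//.
move=> s [_ /= sA].
have -> : p s = 0 by apply/eqP/negPn/negP => /pA.
have -> : q s = 0 by apply/eqP/negPn/negP => /qA.
by rewrite subrr normr0.
Qed.

Lemma Delta_support3 (p q r : Delta) : exists A : {fset S},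
  [/\ [set s | p s != 0] `<=` [set` A], [set s | q s != 0] `<=` [set` A] &
      [set s | r s != 0] `<=` [set` A]].
Proof.
have [[P pP] [[Q qQ] [T rT]]] : (exists A : {fset S}, [set s | p s != 0] = [set` A]) /\
    (exists A : {fset S}, [set s | q s != 0] = [set` A]) /\
    (exists A : {fset S}, [set s | r s != 0] = [set` A]).
  by split; [|split]; apply/finite_fsetP; exact: weight_finite.
exists (P `|` Q `|` T)%fset; rewrite pP qQ rT.
by split => s /= sA; rewrite !inE sA ?orbT.
Qed.

Lemma l1distxx p : l1dist p p = 0.
Proof. by rewrite /l1dist fsbig1// => s _; rewrite subrr normr0. Qed.

Lemma l1dist_positivity p q : l1dist p q = 0 -> p = q.
Proof.
have [A [pA qA _]] := Delta_support3 p q q.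
rewrite (l1dist_fsetE pA qA) => /eqP.
rewrite psumr_eq0// => /allP pq; apply: Delta_eq => s.
have [sA|sA] := boolP (s \in A).
  by have := pq s sA; rewrite /= normr_eq0 subr_eq0 => /eqP.
have -> : p s = 0 by apply/eqP/negPn/negP => /pA /=; rewrite (negbTE sA).
by apply/esym/eqP/negPn/negP => /qA /=; rewrite (negbTE sA).
Qed.

Lemma l1dist_sym p q : l1dist p q = l1dist q p.
Proof. by apply: eq_fsbigr => s _; rewrite distrC. Qed.

Lemma l1dist_triangle q p r : l1dist p r <= l1dist p q + l1dist q r.
Proof.
have [A [pA qA rA]] := Delta_support3 p q r.
rewrite (l1dist_fsetE pA rA) (l1dist_fsetE pA qA) (l1dist_fsetE qA rA).
by rewrite -big_split ler_sum// => s _; exact: ler_distD.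
Qed.

HB.instance Definition _ := @isMetric.Build R Delta
  l1dist l1distxx l1dist_positivity l1dist_sym l1dist_triangle.

Let vertex_weight (v s : S) : R := (s == v)%:R.

Let vertex_itv v s : 0 <= vertex_weight v s <= 1.
Proof. by rewrite /vertex_weight; case: (s == v); rewrite ?ler01 ?lexx. Qed.

Let vertex_finite v : finite_set [set s | vertex_weight v s != 0].
Proof.
apply: (@sub_finite_set _ _ [set v]); last exact: finite_set1.
by move=> s; rewrite /vertex_weight /=; case: (s =P v) => // _; rewrite eqxx.
Qed.

Let vertex_sum v : \sum_(s \in [set: S]) vertex_weight v s = 1.
Proof.
rewrite -(fsbig_widen [set v]) ?fsbig_set1 /vertex_weight ?eqxx//.
by move=> s [_ /= /eqP/negbTE ->].
Qed.

Definition vertex (v : S) : Delta :=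
  MkDelta (vertex_itv v) (vertex_finite v) (vertex_sum v).

Definition face (A : set S) : set Delta := [set p | [set s | p s != 0] `<=` A].

(* The metric of a subcomplex K is the one induced from Delta, so a map into K
   is handled as a map into Delta with range in K. *)
Definition is_subcomplex (K : set Delta) :=
  exists2 F : set (set S), (forall A, F A -> finite_set A /\ A !=set0) &
    K = \bigcup_(A in F) face A.

Definition vertices (K : set Delta) : set S := [set v | K (vertex v)].

Definition star (K : set Delta) (v : S) : set Delta :=
  [set p | K p /\ 0 < p v].

End full_complex.

Arguments Delta : clear implicits.

Definition large_scale_paracompact {R : realType} (X : metricType R) :=
  forall U : set (set X), is_cover U -> uniformly_bounded U ->
  forall lambda C : R, 0 < lambda -> 0 < C ->
    exists (S : choiceType) (K : set (Delta R S)) (f : X -> Delta R S),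
      let V := [set f @^-1` star K v | v in vertices K] in
      [/\ is_subcomplex K, range f `<=` K, coarse_lipschitz lambda C f,
          uniformly_bounded V & refines U V].

(* Main.v *)
(* The coordinates of a map to a simplicial complex are a partition of unity;
   for the cover by points, being coarsely Lipschitz with small constants is
   condition (i) of Property A at a fixed scale.  Conversely, choose a center
   [c s] in the support of each [phi s] and spread the mass [phi s x] uniformly
   over a large ball around [c s].  Bounded geometry makes this a finitely
   supported weight on [X]; spreading does not increase l1-distances, and the
   overlap of the balls makes the star of any point of a member of the given
   cover contain that whole member.  Since the l1-diameter of a complex is at
   most 2, the Lipschitz estimate is only at stake for d(x, y) <= 2 / lambda. *)
Require Import Defs.
From mathcomp Require Import all_boot all_order all_algebra.
From mathcomp Require Import reals topology.
From mathcomp Require Import finmap lra.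
From mathcomp Require Import mathcomp_extra boolp classical_sets functions.
From mathcomp Require Import cardinality fsbigop ereal esum.

Set Implicit Arguments.
Unset Strict Implicit.
Unset Printing Implicit Defensive.

Import Order.TTheory GRing.Theory Num.Theory.

Local Open Scope classical_set_scope.
Local Open Scope ring_scope.

(** * Diameters and finitely supported sums *)

Lemma diam_leP (R : realType) (X : metricType R) (A : set X) (M : R) :
  (diam A <= M%:E)%E <-> (forall x y, A x -> A y -> mdist x y <= M).
Proof.
split=> [AM x y Ax Ay|AM].
  rewrite -lee_fin; apply: le_trans AM; apply: ereal_sup_ubound.
  by exists x => //; exists y.
by apply: ge_ereal_sup => _ [x Ax [y Ay <-]]; rewrite lee_fin AM.
Qed.

(** Bridge between the extended-real sums of Property A and the finite sums that measure [Delta]. *)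
Lemma esum_finite_support (R : realType) (T : choiceType) (f : T -> R)
    (A : {fset T}) :
  (forall t, 0 <= f t) -> [set t | f t != 0] `<=` [set` A] ->
  \esum_(t in [set: T]) (f t)%:E = (\sum_(t <- A) f t)%:E.
Proof.
move=> f0 fA; rewrite (esumID [set` A]) => [|t _]; last by rewrite lee_fin.
rewrite !setTI [X in (_ + X)%E]esum1 ?adde0 => [|t /= tA]; last first.
  by congr EFin; apply/eqP/negPn/negP => /fA.
rewrite esum_fset// => [|t _]; last by rewrite lee_fin.
by rewrite fsbig_finite// set_fsetK sumEFin.
Qed.

Lemma fsum_fset (V : nmodType) (T : choiceType) (f : T -> V) (A : {fset T}) :
  [set t | f t != 0] `<=` [set` A] ->
  \sum_(t \in [set: T]) f t = \sum_(t <- A) f t.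
Proof.
move=> fA; rewrite -(fsbig_widen [set` A])// ?fsbig_finite ?set_fsetK//.
by move=> t [_ /= tA]; apply/eqP/negPn/negP => /fA.
Qed.

(** * Uniform weights on finite sets *)

Section uniform_weight.
Context {R : numFieldType} {T : choiceType}.
Implicit Types (D A : {fset T}).

(** For empty [D] the inverse of 0 is 0, so the total mass is 0 instead of 1. *)
Definition uniform D (t : T) : R := (t \in D)%:R / #|`D|%:R.

Lemma uniform_ge0 D t : 0 <= uniform D t.
Proof. by rewrite divr_ge0// ler0n. Qed.

Lemma uniform_gt0 D t : (0 < uniform D t) = (t \in D).
Proof.
rewrite /uniform; have [tD|_] := boolP (t \in D); last by rewrite mul0r ltxx.
by rewrite mul1r invr_gt0 ltr0n cardfs_gt0; apply/fset0Pn; exists t.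
Qed.

Lemma sum_uniform D A :
  \sum_(t <- A) uniform D t = #|` A `&` D|%fset%:R / #|`D|%:R.
Proof.
rewrite -mulr_suml; congr (_ / _).
have -> : (A `&` D = [fset t in A | t \in D])%fset.
  by apply/fsetP => t; rewrite !inE.
rewrite card_fset_sum1 natr_sum -big_fset_condE [RHS]big_mkcond.
by apply: eq_bigr => t _; case: (t \in D).
Qed.

Lemma sum_uniform_le1 D A : \sum_(t <- A) uniform D t <= 1.
Proof.
rewrite sum_uniform; have [->|D0] := eqVneq D fset0.
  by rewrite cardfs0 invr0 mulr0.
rewrite ler_pdivrMr ?ltr0n ?cardfs_gt0// mul1r ler_nat.
exact: fsubset_leq_card (fsubsetIr _ _).
Qed.

Lemma sum_uniform_eq1 D A : D != fset0 -> (D `<=` A)%fset ->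
  \sum_(t <- A) uniform D t = 1.
Proof.
move=> D0 /fsetIidPr DA.
by rewrite sum_uniform DA divff// pnatr_eq0 cardfs_eq0.
Qed.

End uniform_weight.

(** * Pushing weights forward along a sub-Markov kernel *)

Section pushforward.
Context {R : realType} {S T : choiceType} (k : S -> T -> R).
Hypothesis k_ge0 : forall s t, 0 <= k s t.
Hypothesis k_le1 : forall s (A : {fset T}), \sum_(t <- A) k s t <= 1.

(** [fine] turns an infinite sum into 0; [pushE] excludes this by summability of [w]. *)
Definition push (w : S -> R) (t : T) : R :=
  fine (\esum_(s in [set: S]) (w s * k s t)%:E).

Let wk_ge0 (w : S -> R) s t : (forall s, 0 <= w s) -> (0 <= (w s * k s t)%:E)%E.
Proof. by move=> w0; rewrite lee_fin mulr_ge0. Qed.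

Let kernel_le1 s t : k s t <= 1.
Proof. by have := k_le1 s [fset t]%fset; rewrite big_seq_fset1. Qed.

Lemma push_ge0 (w : S -> R) t : (forall s, 0 <= w s) -> 0 <= push w t.
Proof. by move=> w0; apply/fine_ge0/esum_ge0 => s _; exact: wk_ge0. Qed.

Lemma pushE (w : S -> R) t : (forall s, 0 <= w s) ->
  (\esum_(s in [set: S]) (w s)%:E < +oo)%E ->
  (push w t)%:E = \esum_(s in [set: S]) (w s * k s t)%:E.
Proof.
move=> w0 woo; rewrite fineK// ge0_fin_numE; last first.
  by apply: esum_ge0 => s _; exact: wk_ge0.
by apply: le_lt_trans woo; apply: le_esum => s _; rewrite lee_fin ler_piMr.
Qed.

Lemma sum_push (w : S -> R) (A : {fset T}) : (forall s, 0 <= w s) ->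
  (\esum_(s in [set: S]) (w s)%:E < +oo)%E ->
  (\sum_(t <- A) push w t)%:E =
  \esum_(s in [set: S]) (w s * \sum_(t <- A) k s t)%:E.
Proof.
move=> w0 woo; rewrite -sumEFin.
under eq_bigr do rewrite pushE//.
rewrite -esum_sum => [|s t _ _]; last exact: wk_ge0.
by apply: eq_esum => s _; rewrite sumEFin mulr_sumr.
Qed.

Lemma push_neq0 (w : S -> R) t : push w t != 0 ->
  exists s, w s != 0 /\ k s t != 0.
Proof.
move=> pt; apply: contrapT => /forallNP wk; move/eqP: pt; apply.
rewrite /push esum1// => s _.
have [->|ws] := eqVneq (w s) 0; first by rewrite mul0r.
have [->|ks] := eqVneq (k s t) 0; first by rewrite mulr0.
by case: (wk s).
Qed.

Lemma push_gt0 (w : S -> R) s t : (forall s, 0 <= w s) ->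
  (\esum_(s in [set: S]) (w s)%:E < +oo)%E ->
  0 < w s -> 0 < k s t -> 0 < push w t.
Proof.
move=> w0 woo ws ks; rewrite -lte_fin pushE//.
apply: (@lt_le_trans _ _ (w s * k s t)%:E); first by rewrite lte_fin mulr_gt0.
by apply: esum_ge; exists [set s]; [split|rewrite fsbig_set1].
Qed.

(** Integrates the pointwise bound of [w] by [w'] plus the distance; the additive form avoids
    subtraction in the extended reals. *)
Let push_leD (w w' : S -> R) t :
  (forall s, 0 <= w s) -> (forall s, 0 <= w' s) ->
  (\esum_(s in [set: S]) (w s)%:E < +oo)%E ->
  (\esum_(s in [set: S]) (w' s)%:E < +oo)%E ->
  (\esum_(s in [set: S]) `|w s - w' s|%:E < +oo)%E ->
  push w t <= push w' t + push (fun s => `|w s - w' s|) t.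
Proof.
move=> w0 w'0 woo w'oo dwoo; rewrite -lee_fin EFinD !pushE//.
rewrite -esumD => [|s _|s _]; [|by rewrite lee_fin mulr_ge0..].
apply: le_esum => s _; rewrite -EFinD lee_fin -mulrDl ler_wpM2r//.
by rewrite -lerBlDl ler_norm.
Qed.

(** A sub-Markov kernel contracts the l1-distance: the difference of two images is dominated by the
    image of the absolute difference, and no row of [k] has mass above 1. *)
Lemma sum_push_dist (w w' : S -> R) (A : {fset T}) :
  (forall s, 0 <= w s) -> (forall s, 0 <= w' s) ->
  (\esum_(s in [set: S]) (w s)%:E < +oo)%E ->
  (\esum_(s in [set: S]) (w' s)%:E < +oo)%E ->
  ((\sum_(t <- A) `|push w t - push w' t|)%:E <=
   \esum_(s in [set: S]) `|w s - w' s|%:E)%E.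
Proof.
move=> w0 w'0 woo w'oo.
(* An infinite right-hand side is trivial; otherwise the difference is summable, as [push_leD] and
   [sum_push] require. *)
have [->|/eqP] := eqVneq (\esum_(s in [set: S]) `|w s - w' s|%:E) +oo%E.
  by rewrite leey.
move=> /eqP; rewrite -ltey => dwoo.
apply: (@le_trans _ _ (\sum_(t <- A) push (fun s => `|w s - w' s|) t)%:E).
  rewrite lee_fin ler_sum// => t _; rewrite ler_distl lerBlDr push_leD//=.
  have E : (fun s => `|w s - w' s|) = (fun s => `|w' s - w s|).
    by apply/funext => s; rewrite distrC.
  by rewrite E push_leD//; under eq_esum do rewrite distrC.
rewrite sum_push//; apply: le_esum => s _.
by rewrite lee_fin ler_piMr.
Qed.

End pushforward.

(** * Supports, vertices and diameter in simplicial complexes *)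

Section full_subcomplex.
Context {R : realType} {S : choiceType}.

Lemma Delta_support_neq0 (p : Delta R S) : [set s | p s != 0] !=set0.
Proof.
apply/set0P/eqP => p0; have /eqP := weight_sum p.
rewrite fsbig1 1?eq_sym ?oner_eq0// => s _.
by apply/eqP/negPn/negP => ps; have : [set s | p s != 0] s by []; rewrite p0.
Qed.

Lemma is_subcomplexT : is_subcomplex [set: Delta R S].
Proof.
exists [set A : set S | finite_set A /\ A !=set0] => //.
apply/seteqP; split=> // p _; exists [set s | p s != 0] => //.
by split; [exact: weight_finite|exact: Delta_support_neq0].
Qed.

(** A face containing [p] contains every vertex in the support of [p]. Thus a coordinate that is
    positive somewhere on [K] has a genuine star. *)
Lemma subcomplex_vertex (K : set (Delta R S)) (p : Delta R S) (s : S) :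
  is_subcomplex K -> K p -> 0 < p s -> vertices K s.
Proof.
move=> [F _ ->] [A FA pA] ps; exists A => //.
move=> t /=; have [-> _|] := eqVneq t s; last by rewrite eqxx.
by apply: pA; rewrite /= gt_eqF.
Qed.

Lemma l1dist_le2 (p q : Delta R S) : l1dist p q <= 2.
Proof.
have [A [pA qA _]] := Delta_support3 p q q.
have p_ge0 (r : Delta R S) s : 0 <= r s by case/andP: (weight_itv r s).
rewrite (l1dist_fsetE pA qA) (_ : 2 = \sum_(s <- A) (p s + q s)).
  apply: ler_sum => s _; rewrite (le_trans (ler_normB _ _))//.
  by rewrite !ger0_norm.
by rewrite big_split/= -(fsum_fset pA) -(fsum_fset qA) !weight_sum.
Qed.

End full_subcomplex.

(** * The two implications *)

Lemma large_scale_paracompact_property_A (R : realType) (X : metricType R) :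
  large_scale_paracompact X -> property_A X.
Proof.
move=> XP r eps r0 eps0.
have U1 : is_cover [set [set x] | x in [set: X]].
  by apply/seteqP; split=> // x _; exists [set x] => //; exists x.
have U2 : uniformly_bounded [set [set x] | x in [set: X]].
  by exists 0 => _ [x _ <-]; apply/diam_leP => _ _ -> ->; rewrite mdistxx.
(* For points at distance at most [r] these constants give the bound [eps / 4 + eps / 4], strictly
   below [eps]. *)
have [||S [K [f [Kc fK fL [M VM] _]]]] := XP _ U1 U2 (eps / 4 / r) (eps / 4).
- by rewrite !divr_gt0.
- by rewrite divr_gt0.
have f_ge0 x s : 0 <= f x s by case/andP: (weight_itv (f x) s).
(* The bound [M] on the stars need not be positive. *)
exists (Num.max M 1); split; first by rewrite lt_max ltr01 orbT.
exists S, (fun s x => f x s); split.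
- split=> [s x|x]; first exact: weight_itv.
  have [A [fA _ _]] := Delta_support3 (f x) (f x) (f x).
  by rewrite (esum_finite_support (A := A))// -fsum_fset// weight_sum.
- move=> x y xy; have [A [xA yA _]] := Delta_support3 (f x) (f y) (f y).
  rewrite (esum_finite_support (A := A))//; last first.
    move=> s /=; have [fx|/xA//] := eqVneq (f x s) 0.
    by have [fy|/yA//] := eqVneq (f y s) 0; rewrite fx fy subrr normr0 eqxx.
  rewrite lte_fin -(l1dist_fsetE xA yA).
  apply: le_lt_trans (fL x y) _.
  apply: (@le_lt_trans _ _ (eps / 4 + eps / 4)); last lra.
  rewrite lerD2r -[leRHS](divfK (lt0r_neq0 r0)) ler_wpM2l//.
  by rewrite !divr_ge0// ltW.
- move=> s; apply/diam_leP => x y /= xs ys; rewrite le_max.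
  have Vs : [set f @^-1` star K v | v in vertices K] (f @^-1` star K s).
    by exists s => //; apply: subcomplex_vertex xs => //; apply: fK; exists x.
  have /diam_leP -> // := VM _ Vs.
  + by split=> //; apply: fK; exists x.
  + by split=> //; apply: fK; exists y.
Qed.

Lemma property_A_large_scale_paracompact (R : realType) (X : metricType R) :
  (forall (r : R) (x : X), 0 < r -> finite_set (ball x r)) ->
  property_A X -> large_scale_paracompact X.
Proof.
move=> fin_ball XA U Ucov [B UB] lambda C lambda0 C0.
(* A point [x0] is needed as default center; over an empty space the map into any complex will
   do. *)
have [[x0 _]|X0] := pselect ([set: X] !=set0); last first.
  have noX (x : X) : False by apply: X0; exists x.
  exists nat, setT, (fun=> vertex 0%N); split => //.
  - exact: is_subcomplexT.
  - by exists 0 => _ [v _ <-]; apply/diam_leP => x; case: (noX x).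
  - move=> A _; exists ((fun=> @vertex R nat 0%N) @^-1` star setT 0%N).
      by exists 0%N.
    by move=> x; case: (noX x).
(* Up to distance [2 / lambda] the additive constant alone absorbs the variation, hence the
   tolerance [C]. *)
have [|M [M0 [S [phi [[phi01 phi1] phiL phiM]]]]] := XA (2 / lambda) C _ C0.
  by rewrite divr_gt0.
have phi_ge0 s x : 0 <= phi s x by case/andP: (phi01 s x).
have phioo x : (\esum_(s in [set: S]) (phi s x)%:E < +oo)%E by rewrite phi1 ltry.
(* If [phi s] vanishes identically, the condition on [c s] is vacuous and [x0] serves. *)
have /choice[c cP] : forall s, exists c, forall x, 0 < phi s x -> mdist c x <= M.
  move=> s; have [[c sc]|s0] := pselect (exists c, 0 < phi s c).
    by exists c => x sx; have /diam_leP := phiM s; exact.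
  by exists x0 => x sx; exfalso; apply: s0; exists x.
(* With [B] bounding the diameters of [U], the ball around [c s] contains all of
   every member of [U] that meets the support of [phi s]. *)
pose r := M + `|B| + 1.
have r0 : 0 < r by rewrite /r; have := normr_ge0 B; lra.
(* [fset_set] of an infinite set is empty, so this criterion rests on [fin_ball]. *)
have BE q (x y : X) : 0 < q -> (y \in fset_set (ball x q)) = (mdist x y < q).
  move=> q0; rewrite in_fset_set; last exact: fin_ball.
  by apply/idP/idP; rewrite inE ballEmdist.
pose D s := fset_set (ball (c s) r).
have DE s x : (x \in D s) = (mdist (c s) x < r) by exact: BE.
have D0 s : D s != fset0 by apply/fset0Pn; exists (c s); rewrite DE mdistxx.
pose k s : X -> R := uniform (D s).
have k_ge0 s t : 0 <= k s t by exact: uniform_ge0.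
have k_le1 s (A : {fset X}) : \sum_(t <- A) k s t <= 1 by exact: sum_uniform_le1.
pose g x := push k (phi^~ x).
(* Mass at [x] moves at most [M] to a center and then less than [r] away from it. *)
have near_g x v : g x v != 0 -> mdist x v < M + r.
  move=> /push_neq0 [s [sx sv]].
  apply: le_lt_trans (metric_triangle _ (c s) _) _.
  apply: ler_ltD.
    by rewrite metric_sym; apply: cP; rewrite lt_def sx phi_ge0.
  by rewrite -DE -(uniform_gt0 (R := R)) lt_def sv; exact: k_ge0.
have Mr0 : 0 < M + r by rewrite addr_gt0.
pose E (x : X) := fset_set (ball x (M + r)).
have EE x v : (v \in E x) = (mdist x v < M + r) by exact: BE.
have gE x : [set v | g x v != 0] `<=` [set` E x].
  by move=> v /= /near_g; rewrite EE.
have g_ge0 x v : 0 <= g x v by exact: push_ge0.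
(* Spreading loses no mass: whenever [phi s x] is nonzero, [D s] lies inside [E x]. *)
have g_sum x : \sum_(v <- E x) g x v = 1.
  apply: EFin_inj; rewrite sum_push// -[RHS](phi1 x).
  apply: eq_esum => s _; have [->|sx] := eqVneq (phi s x) 0.
    by rewrite mul0r.
  rewrite sum_uniform_eq1 ?mulr1//; apply/fsubsetP => v; rewrite DE EE => sv.
  apply: le_lt_trans (metric_triangle _ (c s) _) _.
  apply: ler_ltD (sv).
  by rewrite metric_sym; apply: cP; rewrite lt_def sx phi_ge0.
have g_itv x v : 0 <= g x v <= 1.
  rewrite g_ge0/=; have [->|/gE vE] := eqVneq (g x v) 0; first exact: ler01.
  by rewrite -(g_sum x) (big_fsetD1 v)//= lerDl sumr_ge0.
have g_fin x : finite_set [set v | g x v != 0].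
  by apply: sub_finite_set (gE x) _; exact: finite_fset.
have g_fsum x : \sum_(v \in [set: X]) g x v = 1 by rewrite (fsum_fset (gE x)).
pose f x : Delta R X := MkDelta (g_itv x) (g_fin x) (g_fsum x).
exists X, setT, f; split => //.
- exact: is_subcomplexT.
- move=> x y; rewrite -[leLHS]/(l1dist (f x) (f y)); have [xy|xy] := leP (mdist x y) (2 / lambda).
    apply: (@le_trans _ _ C); last by rewrite lerDr mulr_ge0 ?mdist_ge0// ltW.
    have [A [xA yA _]] := Delta_support3 (f x) (f y) (f y).
    rewrite -lee_fin (l1dist_fsetE xA yA); apply/ltW.
    by apply: le_lt_trans (phiL x y xy); exact: sum_push_dist.
  apply: le_trans (l1dist_le2 _ _) _.
  by move: xy; rewrite ltr_pdivrMr// mulrC => /ltW xy; lra.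
- exists (M + r + (M + r)) => _ [v _ <-]; apply/diam_leP => x y [_ /= xv] [_ yv].
  apply: le_trans (metric_triangle _ v _) _; apply: lerD; apply/ltW.
    by apply: near_g; rewrite gt_eqF.
  by rewrite metric_sym; apply: near_g; rewrite gt_eqF.
- move=> A UA; have [[v Av]|A0] := pselect (A !=set0); last first.
    by exists (f @^-1` star setT x0); [exists x0|move=> x Ax; case: A0; exists x].
  exists (f @^-1` star setT v); first by exists v.
  move=> x Ax; split=> //=.
  have [s sx] : exists s, phi s x != 0.
    apply: contrapT => /forallNP x_0; have := phi1 x; rewrite esum1.
      by move=> /eqP; rewrite eqe eq_sym oner_eq0.
    move=> s _; rewrite (_ : phi s x = 0)//.
    by have [//|/x_0] := eqVneq (phi s x) 0.
  (* The center [c s] is within [M] of [x], and [x] within [B] of [v]; the summand 1 in [r] puts [v]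
     strictly inside the ball, so [v] receives part of the mass [phi s x]. *)
  have sx0 : 0 < phi s x by rewrite lt_def sx phi_ge0.
  apply: (@push_gt0 _ _ _ _ k_ge0 k_le1 _ s) => //; rewrite uniform_gt0 DE.
  apply: le_lt_trans (metric_triangle _ x _) _; rewrite /r -addrA.
  apply: ler_ltD; first exact: cP.
  have /diam_leP/(_ x v Ax Av) := UB A UA; have := ler_norm B; lra.
Qed.

Theorem theorem4p4 (R : realType) (X : metricType R) :
  bounded_geometry X -> (property_A X <-> large_scale_paracompact X).
Proof.
move=> bX; split; last exact: large_scale_paracompact_property_A.
apply: property_A_large_scale_paracompact => r x r0; have [M bM] := bX r r0.
by apply/finite_set_leP; exists M.
Qed.
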